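(* Let $n\ge 3$ and $N>2$ be integers and let $f\colon[-1,1)\to\mathbb{R}$ be a potential function. Let $c\in\mathbb{R}$ and, for each integer $k\ge 0$, let $F_k$ be an infinite real symmetric matrix (indexed by $i,j\ge 0$) with only finitely many nonzero entries, and define $$H(u,v,t)=c+\sum_{k\ge 0}\langle F_k,T^n_k(u,v,t)\rangle$$ for $(u,v,t)\in D$ (the series being assumed to converge on $D$). If $F_k\succeq 0$ for all $k$ and $$H(u,v,t)\le\frac{f(u)+f(v)+f(t)}{3}$$ for all $(u,v,t)\in D$, then the minimal value of $\widetilde{E}_f$ for $N$ points in $S^{n-1}$ is at least $$\frac N2\big((N-1)c-\langle F_0,J\rangle\big),$$ i.e. $\widetilde{E}_f(\mathcal{C})\ge\frac N2\big((N-1)c-\langle F_0,J\rangle\big)$ for every $\mathcal{C}\subset S^{n-1}$ with $|\mathcal{C}|=N$.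
   Context: For a function $f\colon[-1,1)\to\mathbb{R}$ and a finite set $\mathcal{C}\subset S^{n-1}$ (the unit sphere in $\mathbb{R}^n$), $\widetilde{E}_f(\mathcal{C})=\frac12\sum_{x,y\in\mathcal{C},\,x\ne y}f(\langle x,y\rangle)$. Set $$D=\{(u,v,t)\in\mathbb{R}^3:-1\le u,v,t<1\text{ and }1+2uvt-u^2-v^2-t^2\ge 0\}.$$ For $m\ge 2$, $P^m_k$ denotes the degree $k$ Gegenbauer polynomial for $S^{m-1}$: these polynomials are orthogonal with respect to $(1-t^2)^{(m-3)/2}\,dt$ on $[-1,1]$ and normalized by $P^m_k(1)=1$. $S^n_k(u,v,t)$ is the infinite matrix whose $(i,j)$-entry ($i,j=0,1,2,\dots$) is the symmetrization in $u,v,t$ (the average over all $6$ permutations of the variables) of $$u^iv^j\big((1-u^2)(1-v^2)\big)^{k/2}P^{n-1}_k\left(\frac{t-uv}{\sqrt{(1-u^2)(1-v^2)}}\right),$$ which is a polynomial in $u,v,t$ (and is interpreted as such wherever the formula is undefined). Define $$T^n_k(u,v,t)=(N-2)S^n_k(u,v,t)+S^n_k(u,u,1)+S^n_k(v,v,1)+S^n_k(t,t,1).$$ $J$ is the infinite matrix with all entries $1$. The inner product of symmetric matrices is $\langle A,B\rangle=\mathrm{tr}(AB)=\sum_{i,j}A_{i,j}B_{i,j}$ (well defined if one of them has only finitely many nonzero entries). $A\succeq 0$ means that $A$ is symmetric and positive semidefinite. *)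

(* Defs.v *)
From HB Require Import structures.
From mathcomp Require Import all_boot all_order all_algebra finmap.
From mathcomp Require Import all_classical all_reals all_analysis ring.

Set Implicit Arguments.
Unset Strict Implicit.
Unset Printing Implicit Defensive.

Import Order.TTheory GRing.Theory Num.Theory.
Import numFieldNormedType.Exports.

Local Open Scope classical_set_scope.
Local Open Scope ring_scope.

Section Energy.
Context {R : realType}.

Definition dotv n (x y : 'rV[R]_n) : R := \sum_(i < n) x ord0 i * y ord0 i.

Definition on_sphere n (C : {fset 'rV[R]_n}) : Prop :=
  forall x, x \in C -> dotv x x = 1.

(* Only the values of [f] on [-1, 1) matter: distinct unit vectors have an
   inner product in this interval. *)
Definition energy n (f : R -> R) (C : {fset 'rV[R]_n}) : R :=
  2^-1 * \sum_(x <- C) \sum_(y <- C | x != y) f (dotv x y).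

Definition inD (u v t : R) : bool :=
  [&& -1 <= u < 1, -1 <= v < 1, -1 <= t < 1 &
      0 <= 1 + 2 * u * v * t - u ^+ 2 - v ^+ 2 - t ^+ 2].

End Energy.

Section ThreePoint.
Context {R : realType}.

Definition is_gegenbauer (m : nat) (P : nat -> {poly R}) : Prop :=
  [/\ forall k, size (P k) = k.+1,
      forall k, (P k).[1] = 1 &
      forall k l, k != l ->
        (\int[lebesgue_measure]_(t in `[(-1)%R, 1%R])
          ((P k).[t] * (P l).[t] * (1 - t ^+ 2) `^ ((m%:R - 3) / 2))%:E = 0)%E].

(* For [2 <= m] there is exactly one such family, so the default value is
   irrelevant. *)
Definition gegenbauer (m : nat) : nat -> {poly R} :=
  xget (fun=> 0) [set P | is_gegenbauer m P].

Lemma size_gegenbauer m k : (size (gegenbauer m k) <= k.+1)%N.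
Proof.
rewrite /gegenbauer; case: xgetP => [P _ [-> _ _]//|_].
by rewrite size_poly0.
Qed.

(* With [w = (1 - u^2) (1 - v^2)], this is
   [w^(k/2) P_k ((t - u v) / sqrt w)] multiplied out, so that no division
   remains.  As [P_k] has the parity of [k], only even powers of [sqrt w] occur;
   hence wherever [0 <= w], in particular for all [u], [v] in [-1, 1], this is
   the value of the polynomial in [u], [v], [t] defined by the formula.
   [zonalE] is the formula itself, for [0 < w], and [zonal_continuous] shows
   that the values at [w = 0] are the right ones. *)
Definition zonal (m k : nat) (u v t : R) : R :=
  \sum_(l < k.+1) (gegenbauer m k)`_l * (t - u * v) ^+ l *
    Num.sqrt ((1 - u ^+ 2) * (1 - v ^+ 2)) ^+ (k - l).

Lemma zonalE m k (u v t : R) : 0 < (1 - u ^+ 2) * (1 - v ^+ 2) ->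
  zonal m k u v t = ((1 - u ^+ 2) * (1 - v ^+ 2)) `^ (k%:R / 2) *
    (gegenbauer m k).[(t - u * v) / Num.sqrt ((1 - u ^+ 2) * (1 - v ^+ 2))].
Proof.
rewrite /zonal; set w := _ * _ => w0.
have s0 : Num.sqrt w != 0 by rewrite gt_eqF// sqrtr_gt0.
rewrite (mulrC k%:R) powRrM powR12_sqrt ?ltW// powR_mulrn ?sqrtr_ge0//.
rewrite (horner_coef_wide _ (size_gegenbauer m k)) mulr_sumr.
apply: eq_bigr => l _.
have -> : Num.sqrt w ^+ k = Num.sqrt w ^+ (k - l) * Num.sqrt w ^+ l.
  by rewrite -exprD subnK// -ltnS.
by rewrite expr_div_n; field; rewrite expf_neq0.
Qed.

Lemma zonal_continuous m k :
  continuous (fun z : R * R * R => zonal m k z.1.1 z.1.2 z.2).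
Proof.
move=> z.
have cu : (x.1.1 : R) @[x --> z] --> z.1.1.
  by apply: (@cvg_comp _ _ _ fst fst _ (nbhs z.1)); exact: cvg_fst.
have cv : (x.1.2 : R) @[x --> z] --> z.1.2.
  apply: (@cvg_comp _ _ _ fst snd _ (nbhs z.1)); first exact: cvg_fst.
  exact: cvg_snd.
have ct : (x.2 : R) @[x --> z] --> z.2 by exact: cvg_snd.
have cX (g : R * R * R -> R) (a : R) i :
    g x @[x --> z] --> a -> g x ^+ i @[x --> z] --> a ^+ i.
  move=> ga; apply: (@cvg_comp _ _ _ g (fun y : R => y ^+ i) _ (nbhs a)) => //.
  exact: exprn_continuous.
have cS (g : R * R * R -> R) (a : R) :
    g x @[x --> z] --> a -> Num.sqrt (g x) @[x --> z] --> Num.sqrt a.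
  move=> ga; apply: (@cvg_comp _ _ _ g Num.sqrt _ (nbhs a)) => //.
  exact: sqrt_continuous.
have cq (g : R * R * R -> R) (a : R) : g x @[x --> z] --> a ->
    1 - g x ^+ 2 @[x --> z] --> 1 - a ^+ 2.
  by move=> ga; apply: cvgB; [exact: cvg_cst|exact: cX].
apply: cvg_big => [|l _]; first exact: add_continuous.
apply: cvgM; last first.
  by apply: cX; apply: cS; apply: cvgM; exact: cq.
apply: cvgM; first exact: cvg_cst.
by apply: cX; apply: cvgB => //; exact: cvgM.
Qed.

Definition symmetrize (g : R -> R -> R -> R) (u v t : R) : R :=
  (g u v t + g u t v + g v u t + g v t u + g t u v + g t v u) / 6.

Definition infmx := nat -> nat -> R.

Definition mxS (n k : nat) (u v t : R) : infmx := fun i j =>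
  symmetrize (fun u v t => u ^+ i * v ^+ j * zonal n.-1 k u v t) u v t.

Definition mxT (n N k : nat) (u v t : R) : infmx := fun i j =>
  (N%:R - 2) * mxS n k u v t i j +
  mxS n k u u 1 i j + mxS n k v v 1 i j + mxS n k t t 1 i j.

Definition mxJ : infmx := fun _ _ => 1.

Definition finsupp_mx (A : infmx) : Prop :=
  finite_set [set ij : nat * nat | A ij.1 ij.2 != 0].

(* A finite sum as soon as [A] or [B] has finite support. *)
Definition mxinner (A B : infmx) : R :=
  \sum_(ij \in [set: nat * nat]) A ij.1 ij.2 * B ij.1 ij.2.

Definition symmetric_mx (A : infmx) : Prop := forall i j, A i j = A j i.

Definition psd (A : infmx) : Prop := symmetric_mx A /\
  forall d (x : nat -> R), 0 <= \sum_(i < d) \sum_(j < d) x i * A i j * x j.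

Definition Hterm (n N : nat) (F : nat -> infmx) (u v t : R) : R^nat :=
  fun k => mxinner (F k) (mxT n N k u v t).

Definition Hfun (n N : nat) (c : R) (F : nat -> infmx) (u v t : R) : R :=
  c + limn (series (Hterm n N F u v t)).

End ThreePoint.

Arguments infmx : clear implicits.

(* Main.v *)
Require Import Defs.
From mathcomp Require Import all_boot all_order all_algebra finmap.
From mathcomp Require Import all_classical all_reals all_analysis.
From mathcomp Require Import measurable_realfun.
From mathcomp Require Import ring lra zify.
From mathcomp Require Import -(notations) mpoly.

Set Implicit Arguments.
Unset Strict Implicit.
Unset Printing Implicit Defensive.

Import Order.TTheory GRing.Theory Num.Theory.
Import numFieldNormedType.Exports.

Local Open Scope ring_scope.

(** Fix a code [C] of [N] unit vectors and sum [H] over the ordered triples of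
    distinct points.  The upper bound on [H] gives at most [2 (N - 2)] times the
    energy.  On the other side, the sum of [T_k] over distinct triples is
    [N - 2] times the sum of [S_k] over all triples, minus
    [(N - 2) N S_k(1,1,1)]; here [S_k(1,1,1)] is [J] for [k = 0] and zero
    otherwise, so everything reduces to the sum of [S_k] over all triples being
    positive semidefinite.

    For a fixed third point [z] this says that [P_k(<x,y>)], made homogeneous, is
    a positive definite kernel on the hyperplane orthogonal to [z].  Orthogonality
    for the weight forces the Gegenbauer differential equation on [P_k], and this
    equation says exactly that [Z_y(x) = |x|^k |y|^k P_k(<x,y>/(|x||y|))] is a
    harmonic polynomial in [x].  In the Fischer inner product multiplication by
    [|x|^2] is adjoint to the Laplacian and [<x,y>^k] is [k!] times the evaluation
    at [y], so [<Z_x, Z_y>] is [k!] times the leading coefficient of [P_k] times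
    [Z_y(x)]: the kernel is a Gram matrix up to a factor, which is positive
    because [Z_x(x) > 0].

    If there were no Gegenbauer family, the polynomials would all be [0] and the
    same argument applies because [<F_0, J> >= 0]; so existence is not needed. *)

(** * Harmonic polynomials and the Fischer inner product *)

(** A finite Gram representation certifies positive definiteness. Keeping the weights [w] apart from
    [phi] avoids square roots. *)
Definition gram_kernel (R : numDomainType) (T : Type) (K : T -> T -> R) :=
  exists (I : finType) (w : I -> R) (phi : I -> T -> R),
    (forall i, 0 <= w i) /\
    forall x y, K x y = \sum_i w i * (phi i x * phi i y).

Section Fischer.
Variables (R : realFieldType) (n : nat).
Implicit Types (p q : mpoly n R) (m : multinom n) (x y : 'I_n -> R).

Local Notation var i := (mpolyX R (mnm1 i) : mpoly n R).
Local Notation cmp c := (mpolyC n c : mpoly n R).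

Definition mfact m : nat := (\prod_(i < n) (m i)`!)%N.

(** The value at $0$ of $p(\partial) q$: monomials are orthogonal, with squared norm the multi-index
    factorial [mfact]. *)
Definition fischer p q : R :=
  \sum_(m <- msupp p) (mfact m)%:R * (mcoeff m p * mcoeff m q).

Lemma fischerE (s : seq (multinom n)) p q : uniq s -> {subset msupp p <= s} ->
  fischer p q = \sum_(m <- s) (mfact m)%:R * (mcoeff m p * mcoeff m q).
Proof.
move=> us sub; rewrite [RHS](bigID (mem (msupp p)))/= [X in _ + X]big1 ?addr0.
  rewrite -big_filter; apply: perm_big; apply: uniq_perm.
  - exact: msupp_uniq.
  - by rewrite filter_uniq.
  - move=> m; rewrite mem_filter /=.
    by case: (boolP (m \in msupp p)) => //= /sub ->.
by move=> m /memN_msupp_eq0 ->; rewrite mul0r mulr0.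
Qed.

Lemma fischer_linearl q c p1 p2 :
  fischer (c *: p1 + p2) q = c * fischer p1 q + fischer p2 q.
Proof.
pose s := undup (msupp p1 ++ msupp p2).
have us : uniq s by exact: undup_uniq.
rewrite !(fischerE _ us).
- rewrite mulr_sumr -big_split /=; apply: eq_bigr => m _.
  by rewrite mcoeffD mcoeffZ; ring.
- by move=> m mp; rewrite mem_undup mem_cat mp orbT.
- by move=> m mp; rewrite mem_undup mem_cat mp.
- move=> m /msuppD_le; rewrite mem_cat => /orP[/msuppZ_le|] mp;
    by rewrite mem_undup mem_cat mp ?orbT.
Qed.

Lemma fischer0l q : fischer 0 q = 0.
Proof. by rewrite /fischer msupp0 big_nil. Qed.

Lemma fischerZl q c p : fischer (c *: p) q = c * fischer p q.
Proof. by rewrite -[_ *: _]addr0 fischer_linearl fischer0l addr0. Qed.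

Lemma fischer_suml q (I : Type) (r : seq I) (P : pred I) (F : I -> mpoly n R) :
  fischer (\sum_(i <- r | P i) F i) q = \sum_(i <- r | P i) fischer (F i) q.
Proof.
apply: (big_morph (fischer^~ q) _ (fischer0l q)) => p1 p2.
by rewrite -[p1]scale1r fischer_linearl fischerZl.
Qed.

Lemma fischerDr p q1 q2 : fischer p (q1 + q2) = fischer p q1 + fischer p q2.
Proof.
by rewrite -big_split /=; apply: eq_bigr => m _; rewrite mcoeffD; ring.
Qed.

Lemma fischerZr p c q : fischer p (c *: q) = c * fischer p q.
Proof. by rewrite mulr_sumr; apply: eq_bigr => m _; rewrite mcoeffZ; ring. Qed.

Lemma fischer0r p : fischer p 0 = 0.
Proof. by rewrite -(scale0r (0 : mpoly n R)) fischerZr mul0r. Qed.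

Lemma fischer_sumr p (I : Type) (r : seq I) (P : pred I) (F : I -> mpoly n R) :
  fischer p (\sum_(i <- r | P i) F i) = \sum_(i <- r | P i) fischer p (F i).
Proof. by apply: (big_morph (fischer p) (fischerDr p) (fischer0r p)). Qed.

Lemma meval_sum x (I : Type) (r : seq I) (P : pred I) (F : I -> mpoly n R) :
  meval x (\sum_(j <- r | P j) F j) = \sum_(j <- r | P j) meval x (F j).
Proof. exact: raddf_sum. Qed.

Lemma mderiv_sum i (I : Type) (r : seq I) (P : pred I) (F : I -> mpoly n R) :
  mderiv i (\sum_(j <- r | P j) F j) = \sum_(j <- r | P j) mderiv i (F j).
Proof. exact: raddf_sum. Qed.

Lemma mfactDU m i : mfact (mnm_add (mnm1 i) m) = ((m i).+1 * mfact m)%N.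
Proof.
rewrite /mfact (bigD1 i)//= [in RHS](bigD1 i)//= mnmDE mnm1E eqxx /=.
rewrite add1n factS -mulnA; congr (_ * (_ * _))%N.
by apply: eq_bigr => j ji; rewrite mnmDE mnm1E eq_sym (negbTE ji).
Qed.

(** Multiplication by a variable is adjoint to the partial derivative because $(m + e_i)! = (m_i +
    1)\, m!$. *)
Lemma fischerMX i p q : fischer (p * var i) q = fischer p (mderiv i q).
Proof.
rewrite /fischer (perm_big _ (msuppMX _ _)) big_map; apply: eq_bigr => m _.
rewrite mcoeffMX mcoeff_mderiv mfactDU natrM.
have -> : mnm_add (mnm1 i) m = mnm_add m (mnm1 i) by exact: addmC.
by set a := _.+1%:R; rewrite !mulrnAr -[RHS]mulr_natr -/a; ring.
Qed.

Definition lap p : mpoly n R := \sum_i mderiv i (mderiv i p).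

Definition lin y : mpoly n R := \sum_i cmp (y i) * var i.

Definition sqn : mpoly n R := \sum_i var i * var i.

Lemma fischerM_sqn p q : fischer (p * sqn) q = fischer p (lap q).
Proof.
rewrite mulr_sumr fischer_suml fischer_sumr; apply: eq_bigr => i _.
by rewrite mulrA !fischerMX.
Qed.

Lemma fischerM_lin y p q :
  fischer (p * lin y) q = fischer p (\sum_i y i *: mderiv i q).
Proof.
rewrite mulr_sumr fischer_suml fischer_sumr; apply: eq_bigr => i _.
by rewrite mulrCA mul_mpolyC fischerZl fischerMX fischerZr.
Qed.

Local Notation homog k := (ishomog1 k (mdeg (n := n))).

Lemma dhomog_mderiv k i q : q \is homog k.+1 -> mderiv i q \is homog k.
Proof.
move/dhomogP => hq; apply/dhomogP => m; rewrite mcoeff_msupp mcoeff_mderiv => h.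
have /hq : mnm_add m (mnm1 i) \in msupp q.
  by rewrite mcoeff_msupp; apply: contra_neq h => ->; rewrite mul0rn.
by rewrite /= mdegD mdeg1 addn1 => -[].
Qed.

Lemma meval_mderivX x i m :
  x i * meval x (mderiv i (mpolyX R m)) = (m i)%:R * meval x (mpolyX R m).
Proof.
rewrite mderivX mevalZ !mevalX mulrCA; case E : (m i) => [|d].
  by rewrite !mul0r.
congr (_ * _); rewrite [LHS]mulrC (bigD1 i)//= [in RHS](bigD1 i)//=.
rewrite mnmBE mnm1E eqxx E subn1 /= mulrAC -exprSr; congr (_ * _).
by apply: eq_bigr => j ji; rewrite mnmBE mnm1E eq_sym (negbTE ji) subn0.
Qed.

(** Euler's identity, checked on monomials: $x_i \partial_i$ multiplies a monomial by its $i$-th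
    exponent, and the exponents add up to [k]. *)
Lemma meval_euler k x q : q \is homog k ->
  \sum_i x i * meval x (mderiv i q) = k%:R * meval x q.
Proof.
move/dhomogP => hq; rewrite {1 2}(mpolyE q).
rewrite [in RHS]raddf_sum /= mulr_sumr.
under eq_bigr => i _ do
  rewrite mderiv_sum meval_sum mulr_sumr.
rewrite exchange_big /= big_seq [in RHS]big_seq.
apply: eq_bigr => m /hq <-.
under eq_bigr => i _.
  rewrite mderivZ mevalZ mulrCA meval_mderivX.
over.
by rewrite -mulr_sumr -mulr_suml mevalZ -natr_sum -mdegE mulrCA.
Qed.

(** Each factor [lin y] moves across as the derivative in direction [y]; evaluated at [y], Euler's
    identity turns it into a factor equal to the degree. *)
Lemma fischer_lin_exp k y q : q \is homog k ->
  fischer (lin y ^+ k) q = (k`!)%:R * meval y q.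
Proof.
elim: k q => [|k IHk] q hq.
  rewrite expr0 /fischer msupp1 big_seq1 mcoeff1 eqxx /= mul1r fact0.
  have -> : q = cmp (mcoeff mnm0 q).
    apply/mpolyP => m; rewrite mcoeffC.
    have [->|m0] := eqVneq m mnm0; first by rewrite mulr1.
    by rewrite mulr0; apply: (dhomog_nemf_coeff hq); rewrite /= mdeg_eq0.
  rewrite mevalC mcoeffC eqxx mulr1 /mfact big1 ?mul1r// => i _.
  by rewrite mnm0E.
rewrite exprSr fischerM_lin fischer_sumr.
under eq_bigr => i _ do
  rewrite fischerZr IHk ?dhomog_mderiv// mulrCA.
by rewrite -mulr_sumr (meval_euler _ hq) mulrA -natrM factS mulnC.
Qed.

Lemma mderivXn i p k : mderiv i (p ^+ k) = k%:R * (p ^+ k.-1 * mderiv i p).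
Proof.
elim: k => [|[|k] IHk]; first by rewrite expr0 mul0r mderivC.
  by rewrite expr1 expr0 !mul1r.
rewrite [in LHS]exprS mderivM IHk /= exprS.
by rewrite -(addn1 k.+1) natrD; ring.
Qed.

Lemma lapM p q : lap (p * q) =
  lap p * q + 2 * (\sum_i mderiv i p * mderiv i q) + p * lap q.
Proof.
rewrite /lap !mulr_sumr mulr_suml -!big_split /=; apply: eq_bigr => i _.
by rewrite mderivM mderivD !mderivM; ring.
Qed.

Lemma mderiv_var i j : mderiv i (var j) = (j == i)%:R.
Proof.
rewrite mderivX mnm1E; case: eqVneq => [->|_]; last by rewrite scale0r.
rewrite scale1r -(mpolyX0 n R); congr mpolyX; apply/mnmP => l.
by rewrite mnmBE subnn mnm0E.
Qed.

Lemma mderiv_lin i y : mderiv i (lin y) = cmp (y i).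
Proof.
rewrite /lin mderiv_sum (bigD1 i)//= big1 ?addr0 => [|j ji].
  by rewrite mderiv_mulC mderiv_var eqxx mulr1.
by rewrite mderiv_mulC mderiv_var (negbTE ji) mulr0.
Qed.

Lemma mderiv_sqn i : mderiv i sqn = 2 * var i.
Proof.
rewrite /sqn mderiv_sum (bigD1 i)//= big1 ?addr0 => [|j ji].
  by rewrite mderivM mderiv_var eqxx mulr1n; ring.
by rewrite mderivM mderiv_var (negbTE ji) mulr0 mul0r addr0.
Qed.

Lemma mderiv_nat i k : mderiv i (k%:R : mpoly n R) = 0.
Proof. by rewrite -mpolyC_nat mderivC. Qed.

Definition dotf x y : R := \sum_i x i * y i.

(** For [a < 2] the truncated exponent [a.-2] is harmless: the coefficient [a * a.-1] is zero. *)
Lemma lap_lin y a :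
  lap (lin y ^+ a) = (a * a.-1)%:R * cmp (dotf y y) * lin y ^+ a.-2.
Proof.
rewrite /lap /dotf raddf_sum /= mulr_sumr mulr_suml; apply: eq_bigr => i _.
rewrite mderivXn mderiv_lin mderivM mderiv_nat mderivM mderivC mderivXn.
by rewrite mderiv_lin natrM mpolyCM; ring.
Qed.

Lemma lap_sqn j :
  lap (sqn ^+ j) = (2 * j * (n + 2 * j.-1))%:R * sqn ^+ j.-1.
Proof.
rewrite /lap; case: j => [|j].
  by rewrite muln0 mul0n mul0r big1// => i _; rewrite expr0 !mderivC.
have H i : mderiv i (mderiv i (sqn ^+ j.+1)) =
    (2 * j.+1)%:R * (sqn ^+ j + (2 * j)%:R * sqn ^+ j.-1 * (var i * var i)).
  rewrite mderivXn mderiv_sqn mderivM mderiv_nat mderivM mderivXn mderiv_sqn /=.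
  by rewrite mderivM mderiv_nat mderiv_var eqxx mulr1n !natrM; ring.
under eq_bigr do rewrite H.
rewrite -mulr_sumr big_split /= sumr_const card_ord -mulr_sumr -/sqn.
case: j {H} => [|j].
  by rewrite muln0 !mul0r addr0 -mulr_natr !natrM; ring.
by rewrite -[_ *+ n]mulr_natr /= [in RHS]exprS !natrM natrD !natrM exprS; ring.
Qed.

Lemma grad_lin_sqn y a j :
  \sum_i mderiv i (lin y ^+ a) * mderiv i (sqn ^+ j) =
  (2 * a * j)%:R * lin y ^+ a * sqn ^+ j.-1.
Proof.
case: a => [|a].
  rewrite muln0 mul0n !mul0r big1// => i _.
  by rewrite expr0 mderivC mul0r.
under eq_bigr => i _.
  rewrite !mderivXn mderiv_lin mderiv_sqn /=.
  have -> : a.+1%:R * (lin y ^+ a * cmp (y i)) *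
      (j%:R * (sqn ^+ j.-1 * (2 * var i))) =
      (2 * a.+1 * j)%:R * lin y ^+ a * sqn ^+ j.-1 * (cmp (y i) * var i).
    by rewrite !natrM; ring.
over.
by rewrite -mulr_sumr -/(lin y) [in RHS]exprS; ring.
Qed.

Lemma lap_lin_sqn y a j : lap (lin y ^+ a * sqn ^+ j) =
  (a * a.-1)%:R * cmp (dotf y y) * (lin y ^+ a.-2 * sqn ^+ j) +
  (2 * j * (n + 2 * j.-1 + 2 * a))%:R * (lin y ^+ a * sqn ^+ j.-1).
Proof.
by rewrite lapM lap_lin lap_sqn grad_lin_sqn !(natrM, natrD); ring.
Qed.

Lemma lap_sum (I : Type) (r : seq I) (F : I -> mpoly n R) :
  lap (\sum_(i <- r) F i) = \sum_(i <- r) lap (F i).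
Proof.
rewrite /lap exchange_big; apply: eq_bigr => i _.
by rewrite !mderiv_sum.
Qed.

Lemma lap_mulC c p : lap (cmp c * p) = cmp c * lap p.
Proof. by rewrite mulr_sumr; apply: eq_bigr => i _; rewrite !mderiv_mulC. Qed.

Section SolidZonal.
Variables (k : nat) (a : nat -> R).

(** The polynomial $Z_y$, with [a] the coefficients of $P_k$. Parity leaves only the indices $k -
    2j$, so $|X|$ and $|y|$ occur to even powers only. *)
Definition solid_zonal y : mpoly n R := \sum_(j < k./2.+1)
  cmp (a (k - 2 * j)%N * dotf y y ^+ j) * (lin y ^+ (k - 2 * j) * sqn ^+ j).

Definition zonal_kernel x y : R := \sum_(j < k./2.+1)
  a (k - 2 * j)%N * dotf x y ^+ (k - 2 * j) * (dotf x x * dotf y y) ^+ j.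

Lemma meval_solid_zonal x y : meval x (solid_zonal y) = zonal_kernel x y.
Proof.
rewrite meval_sum; apply: eq_bigr => j _.
rewrite !mevalM mevalC !rmorphXn /=.
have -> : meval x (lin y) = dotf x y.
  rewrite meval_sum; apply: eq_bigr => i _.
  by rewrite mevalM mevalC mevalXU mulrC.
have -> : meval x sqn = dotf x x.
  rewrite meval_sum; apply: eq_bigr => i _.
  by rewrite mevalM mevalXU.
by rewrite exprMn; ring.
Qed.

Lemma solid_zonal_homog y : solid_zonal y \is homog k.
Proof.
apply: rpred_sum => j _; rewrite mul_mpolyC; apply: rpredZ.
have jk : (2 * j <= k)%N by have := ltn_ord j; lia.
have hlin : lin y \is homog 1.
  apply: rpred_sum => i _.
  by rewrite mul_mpolyC; apply: rpredZ; rewrite dhomogX /= mdeg1.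
have hsqn : sqn \is homog 2.
  apply: rpred_sum => i _.
  by apply: (@dhomogM _ _ _ 1 _ 1); rewrite dhomogX /= mdeg1.
have := dhomogM (dhomogMn (k - 2 * j) hlin) (dhomogMn j hsqn).
by rewrite mul1n subnK.
Qed.

(** The equation $(1-t^2)P'' - (n-1)tP' + k(k+n-2)P = 0$, read off coefficient by coefficient. *)
Hypothesis a_rec : forall l, (l.+2 * l.+1)%:R * a l.+2 +
  (k%:R - l%:R) * (k%:R + l%:R + n%:R - 2) * a l = 0.

(** Each summand contributes two terms to the Laplacian. After an index shift, the terms in $\langle
    X,y\rangle^l |X|^{2j}$ combine to a multiple of the left side of [a_rec]. *)
Lemma lap_solid_zonal y : lap (solid_zonal y) = 0.
Proof.
rewrite /solid_zonal lap_sum.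
under eq_bigr do rewrite lap_mulC lap_lin_sqn mulrDr.
(* The two unpaired end terms vanish: at [j = k./2] the exponent of [lin y] is 0 or 1, and at
   [j = 0] there is no factor [sqn]. *)
rewrite big_split /= big_ord_recr [X in _ + X]big_ord_recl /=.
have -> : ((k - 2 * k./2) * (k - 2 * k./2).-1 = 0)%N.
  by have := odd_double_half k; case: (odd k) => /= h; lia.
rewrite !(muln0, mul0n, mul0r, mulr0, addr0, add0r) -big_split /=.
apply: big1 => j _; rewrite /bump /= add1n add0n.
have := ltn_ord j; move: (nat_of_ord j) => {}j jk.
have [l kl] : exists l, (k = l + 2 + 2 * j)%N.
  by exists (k - 2 - 2 * j)%N; have := odd_double_half k; lia.
have -> : (k - 2 * j = l.+2)%N by lia.
have -> : (k - 2 * j.+1 = l)%N by lia.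
transitivity (cmp (dotf y y ^+ j.+1 * ((l.+2 * l.+1)%:R * a l.+2 +
  (k%:R - l%:R) * (k%:R + l%:R + n%:R - 2) * a l)) * (lin y ^+ l * sqn ^+ j)).
  rewrite kl /= !(exprS, mpolyCM, mpolyCD, mpolyCB, mpolyC_nat, natrM, natrD).
  ring.
by rewrite a_rec mulr0 mpolyC0 mul0r.
Qed.

(** Summands of $Z_x$ with $j > 0$ contain $|X|^2$ and pair to zero with the harmonic $Z_y$; the
    remaining one, $a_k \langle X,x\rangle^k$, evaluates $Z_y$ at [x]. *)
Lemma fischer_solid_zonal x y : fischer (solid_zonal x) (solid_zonal y) =
  a k * (k`!)%:R * zonal_kernel x y.
Proof.
rewrite {1}/solid_zonal fischer_suml big_ord_recl big1 ?addr0 => [|j _] /=.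
  rewrite !expr0 muln0 subn0 !mulr1 mul_mpolyC fischerZl -mulrA.
  rewrite fischer_lin_exp ?solid_zonal_homog// meval_solid_zonal.
  rewrite /zonal_kernel; congr (_ * (_ * _)).
rewrite mul_mpolyC fischerZl /bump add1n (exprSr sqn) mulrA fischerM_sqn.
by rewrite lap_solid_zonal fischer0r mulr0.
Qed.

(** A Gram representation needs one index set for all [x]; the monomials of degree at most [k]
    serve. *)
Lemma fischer_bounded x y : fischer (solid_zonal x) (solid_zonal y) =
  \sum_(m : bmultinom n k.+1) (mfact m)%:R *
    (mcoeff m (solid_zonal x) * mcoeff m (solid_zonal y)).
Proof.
rewrite -(big_map (@bmnm n k.+1) predT (fun m => (mfact m)%:R *
    (mcoeff m (solid_zonal x) * mcoeff m (solid_zonal y)))).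
apply: fischerE.
  by rewrite map_inj_uniq ?index_enum_uniq//; exact: val_inj.
move=> m /(dhomog_mf (solid_zonal_homog x)) /= mk.
have mk1 : (mdeg m < k.+1)%N by rewrite mk.
by apply/mapP; exists (BMultinom mk1); rewrite ?mem_index_enum.
Qed.

(** The sign of [a k] comes without a formula: $a_k\, k!\, K(e,e) = \langle Z_e, Z_e\rangle \ge 0$
    with $K(e,e) > 0$. *)
Lemma zonal_kernel_gram e : a k != 0 -> 0 < zonal_kernel e e ->
  gram_kernel zonal_kernel.
Proof.
move=> ak0 Kee.
have ak : 0 < a k.
  have : 0 <= a k * (k`!)%:R * zonal_kernel e e.
    rewrite -fischer_solid_zonal; apply: sumr_ge0 => m _.
    by rewrite mulr_ge0 ?ler0n// -expr2 sqr_ge0.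
  rewrite pmulr_lge0// pmulr_lge0 ?ltr0n ?fact_gt0//.
  by rewrite le_eqVlt eq_sym (negbTE ak0).
have c0 : 0 < a k * (k`!)%:R by rewrite mulr_gt0// ltr0n fact_gt0.
exists (bmultinom n k.+1),
  (fun m : bmultinom n k.+1 => (a k * (k`!)%:R)^-1 * (mfact m)%:R),
  (fun (m : bmultinom n k.+1) y => mcoeff m (solid_zonal y)); split.
  by move=> m; rewrite mulr_ge0 ?ler0n// invr_ge0 ltW.
move=> x y; apply: (mulfI (lt0r_neq0 c0)).
rewrite -fischer_solid_zonal fischer_bounded mulr_sumr.
by apply: eq_bigr => m _; rewrite !mulrA mulfV ?lt0r_neq0// mul1r.
Qed.

End SolidZonal.

End Fischer.

(** * The Gegenbauer differential equation *)

Section OrthogonalPolynomials.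
Variables (R : realFieldType) (m : nat) (L : {poly R} -> R).
Implicit Types p q r y z : {poly R}.

(** This is $(1-t^2)^{-(m-3)/2}\,\frac{d}{dt}\big((1-t^2)^{(m-1)/2} y'\big)$, the Sturm-Liouville
    form of the Gegenbauer operator. *)
Definition gegen_op y : {poly R} :=
  (1 - 'X^2) * y^`()^`() - (m%:R - 1) *: ('X * y^`()).

Lemma coef_gegen_op y i : (gegen_op y)`_i =
  (i.+2 * i.+1)%:R * y`_i.+2 - i%:R * (i%:R + m%:R - 2) * y`_i.
Proof.
rewrite /gegen_op mulrBl mul1r coefB coefB coefZ coefXnM coefXM !coef_deriv.
case: i => [|[|i]] /=; rewrite ?coef_deriv.
- by ring.
- by ring.
- by rewrite subn2 /=; ring.
Qed.

Lemma size_gegen_op y s : (size y <= s)%N -> (size (gegen_op y) <= s)%N.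
Proof.
move=> ys; apply/leq_sizeP => j sj; rewrite coef_gegen_op.
have y0 i : (s <= i)%N -> y`_i = 0.
  by move=> si; rewrite nth_default// (leq_trans ys).
by rewrite !y0 ?mulr0 ?subrr//; lia.
Qed.

(** [L] abstracts integration against the weight; [Libp] says that the derivative of
    $p\,(1-t^2)^{(m-1)/2}$ integrates to zero. *)
Hypothesis Llin : forall c p q, L (c *: p + q) = c * L p + L q.
Hypothesis Libp :
  forall p, L ((1 - 'X^2) * p^`() - (m%:R - 1) *: ('X * p)) = 0.
Hypothesis Ldef : forall r, L (r * r) = 0 -> r = 0.

Let L0 : L 0 = 0.
Proof. by have := Llin (-1) 0 0; rewrite scaler0 addr0 mulN1r addNr. Qed.

Let LB p q : L (p - q) = L p - L q.
Proof. by rewrite addrC -scaleN1r Llin mulN1r addrC. Qed.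

Lemma gegen_op_selfadjoint y z : L (gegen_op y * z) = L (y * gegen_op z).
Proof.
apply/eqP; rewrite -subr_eq0 -LB; apply/eqP.
have -> : gegen_op y * z - y * gegen_op z =
    ((1 - 'X^2) * (y^`() * z)^`() - (m%:R - 1) *: ('X * (y^`() * z))) -
    ((1 - 'X^2) * (y * z^`())^`() - (m%:R - 1) *: ('X * (y * z^`()))).
  by rewrite /gegen_op !derivM -!mul_polyC; ring.
by rewrite LB !Libp subrr.
Qed.

Variable P : nat -> {poly R}.
Hypothesis sizeP : forall k, size (P k) = k.+1.
Hypothesis orthP : forall k l, k != l -> L (P k * P l) = 0.

Let leadP k : (P k)`_k != 0.
Proof.
by have := lead_coef_eq0 (P k); rewrite -size_poly_eq0 lead_coefE sizeP => ->.
Qed.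

(** Subtracting a multiple of [P s] removes the top coefficient of [q], and [P s] is itself
    orthogonal to [P k]. *)
Lemma orth_low k q : (size q <= k)%N -> L (P k * q) = 0.
Proof.
suff H s : (s <= k)%N -> forall q, (size q <= s)%N -> L (P k * q) = 0.
  exact: H.
elim: s => [|s IHs] sk {}q qs.
  by move: qs; rewrite leqn0 size_poly_eq0 => /eqP ->; rewrite mulr0 L0.
pose c := q`_s / (P s)`_s.
have -> : P k * q = c *: (P k * P s) + P k * (q - c *: P s).
  by rewrite scalerAr -mulrDr addrC subrK.
rewrite Llin orthP ?mulr0 ?add0r ?gtn_eqF//; apply: IHs; first exact: ltnW.
apply/leq_sizeP => j; rewrite leq_eqVlt coefB coefZ => /predU1P[<-|sj].
  by rewrite divfK ?subrr ?leadP.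
by rewrite !nth_default ?mulr0 ?subrr ?sizeP// (leq_trans qs).
Qed.

(** The leading terms of [r] cancel, so [r] and [gegen_op r] have degree below [k]. By
    self-adjointness and [orth_low], [L (r * r)] is zero, hence so is [r], whose coefficients are
    the left sides. *)
Lemma gegenbauer_coef_rec k l :
  (l.+2 * l.+1)%:R * (P k)`_l.+2 +
  (k%:R - l%:R) * (k%:R + l%:R + m%:R - 2) * (P k)`_l = 0.
Proof.
pose lam : R := k%:R * (k%:R + m%:R - 2).
pose r := lam *: P k + gegen_op (P k).
have rE i : r`_i = (i.+2 * i.+1)%:R * (P k)`_i.+2 +
    (k%:R - i%:R) * (k%:R + i%:R + m%:R - 2) * (P k)`_i.
  by rewrite coefD coefZ coef_gegen_op /lam; ring.
have rk : (size r <= k)%N.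
  apply/leq_sizeP => j; rewrite leq_eqVlt rE => /predU1P[<-|kj].
    by rewrite subrr !mul0r addr0 nth_default ?mulr0 ?sizeP.
  by rewrite !nth_default ?mulr0 ?addr0 ?sizeP// ltnW// ltnW.
suff : r = 0 by move=> r0; rewrite -rE r0 coef0.
apply: Ldef; rewrite {1}/r mulrDl -scalerAl Llin gegen_op_selfadjoint.
by rewrite !orth_low ?mulr0 ?addr0// size_gegen_op.
Qed.

Lemma gegenbauer_coef_parity k l : (2 <= m)%N -> (l <= k)%N -> odd (k - l) ->
  (P k)`_l = 0.
Proof.
move=> m2 lk odd_kl.
have [j kl] : exists j, (k - l = j.*2.+1)%N.
  by exists (k - l)./2; rewrite -{1}(odd_double_half (k - l)) odd_kl.
elim: j l lk kl {odd_kl} => [|j IHj] l lk kl; have := gegenbauer_coef_rec k l.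
all: have -> : (P k)`_l.+2 = 0 by
  first [ by rewrite nth_default// sizeP; lia
        | apply: IHj; rewrite ?doubleS in kl *; lia ].
all: rewrite mulr0 add0r => /eqP; rewrite !mulf_eq0 => /orP[/orP[]|/eqP//].
all: try by rewrite subr_eq0 eqr_nat; lia.
all: have -> : k%:R + l%:R + m%:R - 2 = (k + l + (m - 2))%:R :> R by
  rewrite !natrD natrB//; ring.
all: by rewrite pnatr_eq0; lia.
Qed.

End OrthogonalPolynomials.

(** * Integration against the Gegenbauer weight *)

Section GegenbauerWeight.
Local Open Scope classical_set_scope.
Variable R : realType.
Local Notation mu := (@lebesgue_measure R).
Implicit Types (t : R) (p q r : {poly R}).

(** Here [f] may be unbounded near the endpoints, as the weight is for [m = 2]. The integral
    function minus [F] has zero derivative inside and is continuous up to the ends, hence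
    constant. *)
Lemma integrable_FTC2 (f F : R -> R) (a b : R) : a < b ->
  mu.-integrable `[a, b] (EFin \o f) ->
  {in `]a, b[%R, continuous f} ->
  (forall x : R, x \in `]a, b[%R -> is_derive x 1 F (f x)) ->
  {within `[a, b], continuous F} ->
  \int[mu]_(x in `[a, b]) f x = F b - F a.
Proof.
move=> ab intf cf dF cF.
pose G := parameterized_integral mu a ^~ f.
have cG : {within `[a, b], continuous G}.
  by apply: parameterized_integral_continuous => //; exact: ltW.
have dGF x : x \in `]a, b[%R -> is_derive x 1 (G - F) 0.
  move=> xab; move: (xab); rewrite in_itv/= => /andP[ax xb].
  have [dG G'] := continuous_FTC1_closed xb intf ax (cf _ xab).
  have dGx : is_derive x 1 G (f x) by rewrite -G' derive1E; exact/derivableP.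
  by rewrite -(subrr (f x)); apply: is_deriveB; exact: dF.
have cGF : {within `[a, b], continuous (G - F)}.
  by move=> x; apply: cvgB; [exact: cG|exact: cF].
have [c _] := MVT ab dGF cGF; rewrite mul0r !fctE.
have -> : G a = 0.
  by rewrite /G /parameterized_integral set_itv1 Rintegral_set1.
by rewrite -[\int[mu]_(x in _) _]/(G b); lra.
Qed.

Definition sqrt1m t := Num.sqrt (1 - t ^+ 2).

Lemma onem_sqr_gt0 t : t \in `]-1, 1[%R -> 0 < 1 - t ^+ 2.
Proof. by rewrite in_itv/= => /andP[? ?]; nra. Qed.

Lemma onem_sqr_ge0 t : t \in `[-1, 1]%R -> 0 <= 1 - t ^+ 2.
Proof. by rewrite in_itv/= => /andP[? ?]; nra. Qed.

Lemma sqrt1m_gt0 t : t \in `]-1, 1[%R -> 0 < sqrt1m t.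
Proof. by move=> /onem_sqr_gt0; rewrite sqrtr_gt0. Qed.

Lemma continuous_sqrt1m : continuous sqrt1m.
Proof.
move=> t; apply: (@continuous_comp _ _ _ (fun t => 1 - t ^+ 2) Num.sqrt).
  by apply: cvgB; [exact: cvg_cst|exact: exprn_continuous].
exact: sqrt_continuous.
Qed.

Lemma is_derive_sqrt1m t : t \in `]-1, 1[%R ->
  is_derive t 1 sqrt1m (- t / sqrt1m t).
Proof.
move=> /onem_sqr_gt0 t1.
have d1 : is_derive t 1 (fun x : R => 1 - x ^+ 2) (- (2 * t)).
  by apply: trigger_derive; rewrite /GRing.scale /=; ring.
have d2 := is_derive1_sqrt t1.
have := @is_derive1_comp _ Num.sqrt (fun x : R => 1 - x ^+ 2) t _ _ d2 d1.
move=> /trigger_derive; apply.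
by rewrite /sqrt1m; field; rewrite gt_eqF// sqrtr_gt0.
Qed.

Lemma measurable_onem_sqr_powR (x : R) (D : set R) :
  measurable_fun D (fun t => (1 - t ^+ 2) `^ x).
Proof.
apply: measurable_funTS; apply: (measurableT_comp (measurable_powR x)).
by apply: measurable_funB => //; exact: measurable_funX.
Qed.

Lemma continuous_onem_sqr_powR (x t : R) : t \in `]-1, 1[%R ->
  {for t, continuous (fun t => (1 - t ^+ 2) `^ x)}.
Proof.
move=> /onem_sqr_gt0 t1.
apply: (@continuous_comp _ _ _ (fun t => 1 - t ^+ 2) (@powR R ^~ x)).
  by apply: cvgB; [exact: cvg_cst|exact: exprn_continuous].
apply: differentiable_continuous; apply/derivable1_diffP.
by apply: derivable_powR; rewrite in_itv/= t1.
Qed.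

(** The arcsine is a primitive, so the integrals over the intervals [S i] exhausting the open
    interval stay below [pi]; monotone convergence concludes. *)
Lemma integrable_powR_Nhalf :
  mu.-integrable `[(-1)%R, 1%R] (EFin \o (fun t => (1 - t ^+ 2) `^ (- 2^-1))).
Proof.
have mf D := measurable_onem_sqr_powR (- 2^-1) D.
set f := (fun t => (1 - t ^+ 2) `^ (- 2^-1)) in mf *.
have f0 t : 0 <= f t by exact: powR_ge0.
apply/integrableP; split; first by apply/measurable_EFinP; exact: mf.
under eq_integral do rewrite /= ger0_norm ?f0//.
rewrite integral_itv_bndoo; last by apply/measurable_EFinP; exact: mf.
pose a (i : nat) : R := 1 - i.+2%:R^-1.
pose S i : set R := `[- a i, a i].
have a01 i : 0 < a i < 1.
  rewrite /a subr_gt0 invf_lt1 ?ltr0n// ltr1n /=.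
  by rewrite ltrBlDr ltrDl invr_gt0 ltr0n.
have -> : `](-1)%R, 1%R[%classic = \bigcup_i S i.
  apply/seteqP; split=> t /=.
    rewrite in_itv/= => /andP[t1 t2].
    have e0 : 0 < 1 - `|t| by rewrite subr_gt0 ltr_norml t1.
    have [i ie] := ltr_add_invr e0.
    exists i => //; rewrite /S /= in_itv/= -ler_norml /a.
    have : i.+2%:R^-1 <= i.+1%:R^-1 :> R by rewrite lef_pV2 ?posrE ?ltr0n ?ler_nat.
    move: ie; set x := i.+1%:R^-1; set y := i.+2%:R^-1; lra.
  move=> [i _]; rewrite /S /= !in_itv/= => /andP[t1 t2].
  by have := a01 i; lra.
have aS i t : t \in `[- a i, a i]%R -> t \in `](-1)%R, 1%R[%R.
  by rewrite !in_itv/= => /andP[? ?]; have := a01 i; lra.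
have SI i : (\int[mu]_(t in S i) (f t)%:E =
    (asin (a i))%:E - (asin (- a i))%:E)%E.
  have ai : - a i < a i by have := a01 i; lra.
  apply: continuous_FTC2 => //.
  - apply: continuous_in_subspaceT => t; rewrite inE/= => /aS t1.
    exact: continuous_onem_sqr_powR.
  - have casin t : t \in `[- a i, a i]%R -> {for t, continuous (@asin R)}.
      by move=> /aS; rewrite in_itv/=; exact: continuous_asin.
    split=> [t ti||].
    + have /aS : t \in `[- a i, a i]%R by exact: subset_itv_oo_cc.
      by rewrite in_itv/= => t1; have /@ex_derive := is_derive1_asin t1.
    + by apply: cvg_at_right_filter; apply: casin; rewrite in_itv/= lexx ltW.
    + by apply: cvg_at_left_filter; apply: casin; rewrite in_itv/= lexx ltW.
  - move=> t ti.
    have /aS t1 : t \in `[- a i, a i]%R by exact: subset_itv_oo_cc.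
    have := onem_sqr_gt0 t1; move: t1; rewrite in_itv/= => t1 t2.
    rewrite derive1E (@derive_val _ _ _ _ _ _ _ (is_derive1_asin t1)).
    by rewrite /f powRN powR12_sqrt ?ltW.
apply: (@le_lt_trans _ _ (pi : R)%:E); last exact: ltry.
have cv : (\int[mu]_(t in S i) (f t)%:E @[i --> \oo] -->
    \int[mu]_(t in \bigcup_i S i) (f t)%:E)%E.
  apply: ge0_nondecreasing_set_cvg_integral => [||i|i t _].
  - apply/nondecreasing_seqP => i; apply/subsetPset => t /=.
    rewrite /S/= !in_itv/= => /andP[t1 t2].
    have : a i <= a i.+1 by rewrite lerB// lef_pV2 ?posrE ?ltr0n ?ler_nat.
    by lra.
  - by move=> i; exact: measurable_itv.
  - by apply/measurable_EFinP; exact: mf.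
  - by rewrite lee_fin.
rewrite -(cvg_lim _ cv)//; apply: lime_le; first by apply/cvg_ex; eexists; exact: cv.
near=> i; rewrite SI -EFinB lee_fin.
have ai : -1 <= a i <= 1 by have := a01 i; lra.
have aNi : -1 <= - a i <= 1 by have := a01 i; lra.
by have := asin_lepi2 ai; have := asin_geNpi2 aNi; lra.
Unshelve. all: by end_near. Qed.

Variable m : nat.
Hypothesis m2 : (2 <= m)%N.

Definition gegen_weight t := (1 - t ^+ 2) `^ ((m%:R - 3) / 2).

Definition gegen_int p : R :=
  \int[mu]_(t in `[(-1)%R, 1%R]) (p.[t] * gegen_weight t).

(** Dividing by [sqrt1m t] keeps the exponent a natural number even for [m = 2]. *)
Lemma gegen_weightE t : t \in `]-1, 1[%R ->
  gegen_weight t = sqrt1m t ^+ (m - 2) / sqrt1m t.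
Proof.
move=> t1; have s0 := sqrt1m_gt0 t1.
rewrite /gegen_weight mulrC powRrM powR12_sqrt -/(sqrt1m t); last first.
  exact/ltW/onem_sqr_gt0.
have -> : m%:R - 3 = (m - 2)%:R - 1 :> R by rewrite natrB//; ring.
rewrite powRB ?powRr1 ?powR_mulrn ?sqrtr_ge0//.
by apply/implyP => _; rewrite gt_eqF.
Qed.

Lemma integrable_poly_weight p :
  mu.-integrable `[(-1)%R, 1%R] (EFin \o (fun t => p.[t] * gegen_weight t)).
Proof.
have mw D : measurable_fun D gegen_weight by exact: measurable_onem_sqr_powR.
have icst : mu.-integrable `[(-1)%R, 1%R] (EFin \o cst (1 : R)).
  apply: continuous_compact_integrable; first exact: segment_compact.
  by apply: continuous_subspaceT => x; exact: cvg_cst.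
have iw : mu.-integrable `[(-1)%R, 1%R] (EFin \o gegen_weight).
  apply: le_integrable (integrableD _ icst integrable_powR_Nhalf) => //.
    by apply/measurable_EFinP; exact: mw.
  move=> t /= t1; rewrite lee_fin !ger0_norm ?powR_ge0 ?addr_ge0 ?powR_ge0//.
  (* The majorant is $1 + (1-t^2)^{-1/2}$. At the endpoints [powR] has base 0 and value 0 or 1,
     which the summand 1 covers; inside, the base is at most 1 and the exponent at least $-1/2$. *)
  have := onem_sqr_ge0 t1; rewrite le_eqVlt => /predU1P[t0|t0].
    rewrite /gegen_weight -t0; apply: (@le_trans _ _ 1).
      by rewrite /powR eqxx; case: (_ == 0).
    by rewrite lerDl powR_ge0.
  rewrite -[leLHS]add0r lerD ?ler01//; apply: ger_powR.
    by rewrite t0 lerBlDr lerDl sqr_ge0.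
  by have := m2; rewrite -(ler_nat R); lra.
rewrite (_ : _ \o _ = (EFin \o horner p) \* (EFin \o gegen_weight))%E//.
apply: integrableMr => //.
  apply: measurable_funTS; apply: continuous_measurable_fun.
  exact: continuous_horner.
have /compact_bounded[M [Mr HM]] : compact (horner p @` `[(-1)%R, 1%R]).
  apply: continuous_compact; last exact: segment_compact.
  by apply: continuous_subspaceT; exact: continuous_horner.
by exists M; split=> // x Mx t t1; apply: HM => //; exists t.
Qed.

Lemma gegen_int_linear c p q :
  gegen_int (c *: p + q) = c * gegen_int p + gegen_int q.
Proof.
rewrite /gegen_int -RintegralZl//; last exact: integrable_poly_weight.
rewrite -RintegralD//; last exact: integrable_poly_weight.
  by apply: eq_Rintegral => t _; rewrite hornerD hornerZ; ring.
apply: eq_integrable (integrable_poly_weight (c *: p)) => // t _ /=.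
by rewrite hornerZ mulrA.
Qed.

(** The integrand is the derivative of [F], which vanishes at both endpoints because [m.-1] is
    positive. *)
Lemma gegen_int_by_parts p :
  gegen_int ((1 - 'X^2) * p^`() - (m%:R - 1) *: ('X * p)) = 0.
Proof.
pose F t := p.[t] * sqrt1m t ^+ m.-1.
have cF : continuous F.
  move=> t; apply: cvgM; first exact: continuous_horner.
  apply: (@continuous_comp _ _ _ sqrt1m (fun x : R => x ^+ m.-1)).
    exact: continuous_sqrt1m.
  exact: exprn_continuous.
have F1 t : 1 - t ^+ 2 = 0 -> F t = 0.
  move=> t0; rewrite /F /sqrt1m t0 sqrtr0 expr0n.
  by move: m2; case: m => [|[|]]//= k _; rewrite mulr0.
transitivity (F 1 - F (-1)); last by rewrite !F1 ?sqrrN ?expr1n ?subrr.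
apply: integrable_FTC2.
- by lra.
- exact: integrable_poly_weight.
- move=> t t1; apply: cvgM; first exact: continuous_horner.
  exact: continuous_onem_sqr_powR.
- move=> t t1; have s0 := sqrt1m_gt0 t1.
  have dp := is_derive_poly p t.
  have ds := is_derive_sqrt1m t1.
  have [k mk] : exists k, m = k.+2.
    by exists (m - 2)%N; rewrite -[LHS](subnK m2) addn2.
  have dF := is_deriveM dp (is_deriveX m.-1 ds).
  have FE : F = horner p * (sqrt1m ^+ m.-1) :> (R -> R).
    by apply/funext => x; rewrite /F !fctE; congr (_ * _); rewrite exprfctE.
  rewrite FE; apply: (is_derive_eq dF).
  have st : sqrt1m t ^+ 2 = 1 - t ^+ 2.
    by rewrite sqr_sqrtr// ltW// onem_sqr_gt0.
  rewrite gegen_weightE// !hornerE -st /GRing.scale /= exprfctE mk subn2 /=.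
  rewrite -(addn1 k.+1) natrD exprS; field.
  by rewrite gt_eqF.
- exact: continuous_subspaceT.
Qed.

(** A nonnegative integrand with zero integral vanishes almost everywhere. The weight is positive
    inside, so a nonzero [r] would make the open interval negligible up to its finitely many
    roots. *)
Lemma gegen_int_definite r : gegen_int (r * r) = 0 -> r = 0.
Proof.
move=> Lr; apply: contrapT => /eqP r0.
pose f t := (r * r).[t] * gegen_weight t.
have fi : mu.-integrable `[(-1)%R, 1%R] (EFin \o f).
  exact: integrable_poly_weight.
have f0 t : 0 <= f t by rewrite mulr_ge0 ?powR_ge0// hornerM -expr2 sqr_ge0.
have I0 : (\int[mu]_(t in `[(-1)%R, 1%R]) `|(EFin \o f) t| = 0)%E.
  under eq_integral do rewrite /= ger0_norm ?f0//.
  rewrite -(fineK (integrable_fin_num _ fi))//.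
  by congr EFin; exact: Lr.
have [/(_ I0) fae _] :=
  ae_eq_integral_abs mu (measurable_itv `[(-1)%R, 1%R]%R) (measurable_int mu fi).
pose Z : set R := [set t | root r t].
have Zfin : finite_set Z.
  apply: contrapT => /(infinite_set_fset (size r))[B Br].
  rewrite leqNgt => /negP; apply; apply: max_poly_roots => //.
    by apply/allP => t tB; exact: Br.
  exact: fset_uniq.
have Zneg : mu.-negligible Z.
  apply/negligibleP.
    by apply: countable_measurable => //; exact: (finite_set_countable Zfin).
  by apply: countable_lebesgue_measure0; exact: (finite_set_countable Zfin).
have : mu `](-1)%R, 1%R[%classic = 0%E.
  apply: measure_negligible => //.
  apply: negligibleS (negligibleU fae Zneg) => t /= t1.
  have [rt|rt] := boolP (root r t); [by right|left].
  move=> /(_ (subset_itv_oo_cc t1)) [] /eqP; apply/negP.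
  rewrite /f gegen_weightE// hornerM !mulf_neq0// ?expf_neq0 ?invr_neq0//.
  - exact: lt0r_neq0 (sqrt1m_gt0 t1).
  - exact: lt0r_neq0 (sqrt1m_gt0 t1).
rewrite lebesgue_measure_itv /= lte_fin ifT; last by lra.
by rewrite -EFinB => -[]; lra.
Qed.

Section GegenbauerFamily.
Variable P : nat -> {poly R}.
Hypothesis Pgeg : is_gegenbauer m P.

Lemma gegen_int_orthogonal k l : k != l -> gegen_int (P k * P l) = 0.
Proof.
have [_ _ /[apply] orthP] := Pgeg.
rewrite /gegen_int /Rintegral -[RHS]/(fine 0%E) -orthP; congr fine.
by apply: eq_integral => t _; rewrite hornerM.
Qed.

Let sizeP k : size (P k) = k.+1.
Proof. by have [-> _ _] := Pgeg. Qed.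

Lemma is_gegenbauer_rec k l : (l.+2 * l.+1)%:R * (P k)`_l.+2 +
  (k%:R - l%:R) * (k%:R + l%:R + m%:R - 2) * (P k)`_l = 0.
Proof.
exact: gegenbauer_coef_rec gegen_int_linear gegen_int_by_parts
  gegen_int_definite _ sizeP gegen_int_orthogonal k l.
Qed.

Lemma is_gegenbauer_parity k l : (l <= k)%N -> odd (k - l) -> (P k)`_l = 0.
Proof.
exact: gegenbauer_coef_parity gegen_int_linear gegen_int_by_parts
  gegen_int_definite _ sizeP gegen_int_orthogonal k l m2.
Qed.

End GegenbauerFamily.

End GegenbauerWeight.

(** * Positive definiteness of the zonal kernels *)

Lemma dotvC (R : realType) n (x y : 'rV[R]_n) : dotv x y = dotv y x.
Proof. by apply: eq_bigr => i _; rewrite mulrC. Qed.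

(* [h x] lists the last [m] coordinates of the image of [x] under the reflection
   exchanging [z] and the first basis vector [e]; for [z = e] the coefficient
   [b x] has a zero denominator, hence is [0], and [h] is the projection. *)
Lemma tangent_coordinates (R : realType) m (z : 'rV[R]_m.+1) : dotv z z = 1 ->
  exists h : 'rV[R]_m.+1 -> 'I_m -> R, forall x y,
    dotf (h x) (h y) = dotv x y - dotv x z * dotv y z.
Proof.
move=> zz; pose tl (x y : 'rV[R]_m.+1) :=
  \sum_(i < m) x ord0 (lift ord0 i) * y ord0 (lift ord0 i).
have dotE x y : dotv x y = x ord0 ord0 * y ord0 ord0 + tl x y.
  by rewrite /dotv big_ord_recl.
pose b x := (dotv x z - x ord0 ord0) / (1 - z ord0 ord0).
exists (fun (x : 'rV[R]_m.+1) (i : 'I_m) =>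
  x ord0 (lift ord0 i) - b x * z ord0 (lift ord0 i)) => x y.
transitivity (tl x y - b y * tl x z - b x * tl y z + b x * b y * tl z z).
  rewrite !mulr_sumr -!sumrB -big_split /=; apply: eq_bigr => i _; ring.
have tlE u v : tl u v = dotv u v - u ord0 ord0 * v ord0 ord0.
  by rewrite dotE addrAC subrr add0r.
have [z1|z1] := eqVneq (z ord0 ord0) 1.
  have z0 i : z ord0 (lift ord0 i) = 0.
    have /eqP := tlE z z; rewrite zz z1 mulr1 subrr.
    rewrite psumr_eq0 => [/allP/(_ i)|j _]; last by rewrite -expr2 sqr_ge0.
    by rewrite mem_index_enum => /(_ isT); rewrite /= mulf_eq0 orbb => /eqP.
  have tz u : tl u z = 0 by rewrite /tl big1// => i _; rewrite z0 mulr0.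
  by rewrite !tz !dotE !tz z1; ring.
have {}z1 : 1 - z ord0 ord0 != 0 by rewrite subr_eq0 eq_sym.
by rewrite !tlE zz /b; field.
Qed.

Lemma sum_even_index (R : nmodType) k (G : nat -> R) :
  (forall i, (i <= k)%N -> odd i -> G i = 0) ->
  \sum_(i < k.+1) G i = \sum_(j < k./2.+1) G (2 * j)%N.
Proof.
elim: k => [|k IHk] Godd; first by rewrite !big_ord1.
rewrite big_ord_recr /= IHk => [|i ik]; last by apply: Godd; exact: leqW.
have [ok|ek] := boolP (odd k.+1).
  rewrite Godd// addr0 uphalf_half; move: ok => /= /negbTE ->.
  by rewrite add0n.
rewrite uphalf_half; have -> : odd k by move: ek => /=; rewrite negbK.
rewrite add1n [RHS]big_ord_recr /=; congr (_ + G _).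
by move: ek => /=; have := odd_double_half k; lia.
Qed.

Section ZonalGram.
Variables (R : realType) (m : nat).
Hypothesis m2 : (2 <= m)%N.

(** Passes from the square roots in [zonal] to the polynomial form: after reversing the index,
    parity removes the odd powers of the root. *)
Lemma zonal_kernelE n k (a : nat -> R) (x y : 'I_n -> R) :
  (forall l, (l <= k)%N -> odd (k - l) -> a l = 0) ->
  \sum_(l < k.+1) a l * dotf x y ^+ l *
     Num.sqrt (dotf x x * dotf y y) ^+ (k - l) = zonal_kernel k a x y.
Proof.
move=> apar.
have dot_ge0 u : 0 <= dotf u u :> R.
  by apply: sumr_ge0 => i _; rewrite -expr2 sqr_ge0.
rewrite (reindex_inj rev_ord_inj) /=.
pose G i := a (k - i)%N * dotf x y ^+ (k - i) *
  Num.sqrt (dotf x x * dotf y y) ^+ i.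
transitivity (\sum_(i < k.+1) G i).
  apply: eq_bigr => i _; rewrite /G subSS; congr (_ * _ ^+ _).
  by have := ltn_ord i; lia.
rewrite sum_even_index => [|i ik oi].
  apply: eq_bigr => j _; rewrite /G exprM sqr_sqrtr// mulr_ge0//.
by rewrite /G apar ?mul0r ?leq_subr// subKn.
Qed.

Lemma horner_zonal_kernel n k (p : {poly R}) (e : 'I_n -> R) :
  size p = k.+1 -> (forall l, (l <= k)%N -> odd (k - l) -> p`_l = 0) ->
  dotf e e = 1 -> zonal_kernel k (fun l => p`_l) e e = p.[1].
Proof.
move=> sp ppar ee; rewrite -zonal_kernelE// ee mulr1 sqrtr1 horner_coef sp.
by apply: eq_bigr => l _; rewrite !expr1n !mulr1.
Qed.

(** Projecting to the hyperplane orthogonal to [z] turns $t - uv$ into an inner product and $1-u^2$,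
    $1-v^2$ into squared norms, so [zonal] becomes [zonal_kernel] in dimension [m]. *)
Lemma zonal_gram k (T : Type) (p : T -> 'rV[R]_m.+1) (z : 'rV[R]_m.+1) :
  (forall i, dotv (p i) (p i) = 1) -> dotv z z = 1 ->
  gram_kernel (fun i j =>
    zonal m k (dotv (p i) z) (dotv (p j) z) (dotv (p i) (p j))).
Proof.
move=> punit zz; rewrite /zonal /gegenbauer.
case: xgetP => [P _ Pgeg|_]; last first.
  (* Under the default value of [gegenbauer] the kernel is zero: an empty Gram sum. *)
  exists void, (fun=> 0), (fun=> fun=> 0); split=> [[]|i j].
  by rewrite !big1// => l _; rewrite ?coef0 ?mul0r.
have [sizeP P1 _] := Pgeg.
have Prec := is_gegenbauer_rec m2 Pgeg.
have Ppar := is_gegenbauer_parity m2 Pgeg.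
have [h hE] := tangent_coordinates zz.
(* Any unit vector would do: its kernel value is $P_k(1) = 1 > 0$. *)
pose e (i : 'I_m) : R := (i == Ordinal (ltnW m2))%:R.
have ee : dotf e e = 1.
  rewrite /dotf (bigD1 (Ordinal (ltnW m2)))//= big1 /e => [|i /negbTE ->].
    by rewrite eqxx mulr1 addr0.
  by rewrite mul0r.
have Pk0 : (P k)`_k != 0.
  by have := lead_coef_eq0 (P k); rewrite -size_poly_eq0 lead_coefE sizeP => ->.
have := @zonal_kernel_gram _ _ k (fun l => (P k)`_l) (Prec k) e Pk0.
rewrite horner_zonal_kernel// ?P1 ?ltr01//; last exact: Ppar.
move=> /(_ isT) [I [w [phi [w0 phiE]]]].
exists I, w, (fun i t => phi i (h (p t))); split=> // i j.
rewrite -phiE -zonal_kernelE; last exact: Ppar.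
apply: eq_bigr => l _; rewrite hE.
by rewrite !hE !punit -!expr2.
Qed.

End ZonalGram.

(** * Sums over triples of points *)

Section DotProduct.
Variables (R : realType) (n : nat).
Implicit Types x y z : 'rV[R]_n.

Lemma dotvDl x y z : dotv (x + y) z = dotv x z + dotv y z.
Proof. by rewrite -big_split /=; apply: eq_bigr => i _; rewrite mxE mulrDl. Qed.

Lemma dotvZl c x z : dotv (c *: x) z = c * dotv x z.
Proof. by rewrite mulr_sumr; apply: eq_bigr => i _; rewrite mxE mulrA. Qed.

Lemma dotvDr x y z : dotv z (x + y) = dotv z x + dotv z y.
Proof. by rewrite dotvC dotvDl !(dotvC z). Qed.

Lemma dotvZr c x z : dotv z (c *: x) = c * dotv z x.
Proof. by rewrite dotvC dotvZl dotvC. Qed.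

Lemma dotv_ge0 x : 0 <= dotv x x.
Proof. by apply: sumr_ge0 => i _; rewrite -expr2 sqr_ge0. Qed.

Lemma dotv_eq0 x : dotv x x = 0 -> x = 0.
Proof.
move=> /eqP; rewrite psumr_eq0 => [/allP x0|i _]; last by rewrite -expr2 sqr_ge0.
apply/rowP => i; rewrite mxE.
by have := x0 i (mem_index_enum _); rewrite /= mulf_eq0 orbb => /eqP.
Qed.

(* Lagrange's identity *)
Lemma dotv_Cauchy_Schwarz x y : dotv x y ^+ 2 <= dotv x x * dotv y y.
Proof.
have : 0 <= \sum_i \sum_j (x ord0 i * y ord0 j - x ord0 j * y ord0 i) ^+ 2.
  by do 2! (apply: sumr_ge0 => ? _); exact: sqr_ge0.
have -> : \sum_i \sum_j (x ord0 i * y ord0 j - x ord0 j * y ord0 i) ^+ 2 =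
    dotv x x * dotv y y + dotv y y * dotv x x - 2 * (dotv x y * dotv x y).
  have E (a b c d : 'rV[R]_n) : dotv a b * dotv c d = \sum_i \sum_j
      (a ord0 i * b ord0 i) * (c ord0 j * d ord0 j) by exact: big_distrlr.
  rewrite !E mulr_sumr -big_split -sumrB /=; apply: eq_bigr => i _.
  rewrite mulr_sumr -big_split -sumrB /=; apply: eq_bigr => j _; ring.
by rewrite expr2; lra.
Qed.

(** The determinant condition is Cauchy-Schwarz for the components of [y] and [z] orthogonal to [x]:
    $(t-uv)^2 \le (1-u^2)(1-v^2)$. *)
Lemma inD_unit x y z : dotv x x = 1 -> dotv y y = 1 -> dotv z z = 1 ->
  x != y -> x != z -> y != z -> inD (dotv x y) (dotv x z) (dotv y z).
Proof.
move=> xx yy zz xy xz yz.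
have itv (a b : 'rV[R]_n) : dotv a a = 1 -> dotv b b = 1 -> a != b ->
    -1 <= dotv a b < 1.
  move=> aa bb ab; have := dotv_ge0 (a + b).
  rewrite !(dotvDl, dotvDr) aa bb (dotvC b a) => ?.
  have : 0 < dotv (a - b) (a - b).
    rewrite lt_def dotv_ge0 andbT; apply: contra_neq ab => /dotv_eq0/eqP.
    by rewrite subr_eq0 => /eqP.
  rewrite -(scaleN1r b) !(dotvDl, dotvDr, dotvZl, dotvZr) aa bb (dotvC b a) => ?.
  by apply/andP; split; lra.
rewrite /inD !itv//=.
have := dotv_Cauchy_Schwarz (y + (- dotv x y) *: x) (z + (- dotv x z) *: x).
rewrite !(dotvDl, dotvDr, dotvZl, dotvZr) xx yy zz (dotvC y x) (dotvC z x).
by set u := dotv x y; set v := dotv x z; set t := dotv y z; nra.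
Qed.

End DotProduct.

(** * Inner products with finitely supported matrices *)

Section FrobeniusProduct.
Variable R : realType.
Implicit Types A B : infmx R.

(** The bound [d] depends on [A] alone, so products with different [B] become sums over the same
    square and can be added. *)
Lemma mxinner_bounded A : finsupp_mx A -> exists d, forall B,
  mxinner A B = \sum_(i < d) \sum_(j < d) A i j * B i j.
Proof.
move=> /finite_fsetP[S SE].
exists (\max_(ij <- S) (maxn ij.1 ij.2).+1) => B.
set d := \max_(ij <- S) _.
have Sd i j : (i, j) \in S -> (i < d)%N /\ (j < d)%N.
  move=> ijS; have : ((maxn i j).+1 <= d)%N.
    exact: (@leq_bigmax_seq _ _ _ (fun ij => (maxn ij.1 ij.2).+1) (i, j)).
  by rewrite gtn_max => /andP.
pose r := [seq (i, j) | i <- index_iota 0 d, j <- index_iota 0 d].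
have ur : uniq r.
  by rewrite allpairs_uniq ?iota_uniq// => -[? ?] [? ?] _ _ [-> ->].
transitivity (\sum_(ij <- r) A ij.1 ij.2 * B ij.1 ij.2); last first.
  rewrite big_allpairs_dep /= big_mkord; apply: eq_bigr => i _.
  by rewrite big_mkord.
rewrite (bigfs _ ur) => [|[i j] _].
  by rewrite (_ : [set` predT]%classic = setT)//; apply/seteqP; split.
rewrite /mxinner; apply: contraNeq; rewrite mulf_eq0 negb_or => /andP[A0 _].
have : (i, j) \in S.
  by have : [set ij | A ij.1 ij.2 != 0]%classic (i, j) by []; rewrite SE.
by move=> /Sd[id jd]; apply: allpairs_f; rewrite mem_index_iota.
Qed.

(** Expanding [K] gives $\sum_a w_a\, c_a^T A\, c_a$ with $c_a(i) = \sum_x u(x)^i \varphi_a(x)$. *)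
Lemma psd_gram_ge0 (T : finType) A (u : T -> R) (K : T -> T -> R) d : psd A ->
  gram_kernel K ->
  0 <= \sum_(i < d) \sum_(j < d) A i j *
         \sum_x \sum_y u x ^+ i * u y ^+ j * K x y.
Proof.
move=> [_ Apsd] [I [w [phi [w0 KE]]]].
pose c a (i : nat) := \sum_x u x ^+ i * phi a x.
have -> : \sum_(i < d) \sum_(j < d) A i j *
    \sum_x \sum_y u x ^+ i * u y ^+ j * K x y =
    \sum_a w a * \sum_(i < d) \sum_(j < d) c a i * A i j * c a j.
  under [RHS]eq_bigr do rewrite mulr_sumr.
  rewrite [RHS]exchange_big /=; apply: eq_bigr => i _ /=.
  under [RHS]eq_bigr do rewrite mulr_sumr.
  rewrite [RHS]exchange_big /=; apply: eq_bigr => j _ /=.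
  have cE a : w a * (c a i * A i j * c a j) = \sum_x \sum_y
      A i j * (w a * ((u x ^+ i * phi a x) * (u y ^+ j * phi a y))).
    transitivity (A i j * (w a * (c a i * c a j))); first by ring.
    rewrite /c big_distrlr /=.
    by rewrite !mulr_sumr; apply: eq_bigr => x _; rewrite !mulr_sumr.
  under [RHS]eq_bigr do rewrite cE.
  rewrite [RHS]exchange_big mulr_sumr /=; apply: eq_bigr => x _ /=.
  rewrite [RHS]exchange_big mulr_sumr /=; apply: eq_bigr => y _ /=.
  by rewrite KE !mulr_sumr; apply: eq_bigr => a _; ring.
by apply: sumr_ge0 => a _; rewrite mulr_ge0.
Qed.

Lemma mxinner_J_ge0 A : finsupp_mx A -> psd A -> 0 <= mxinner A mxJ.
Proof.
move=> /mxinner_bounded[d dE] [_ Apsd]; rewrite dE.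
have := Apsd d (fun=> 1); congr (0 <= _).
by apply: eq_bigr => i _; apply: eq_bigr => j _; rewrite mul1r.
Qed.

End FrobeniusProduct.

(** * Counting ordered triples *)

Section DistinctTriples.
Variables (R : comNzRingType) (T : finType).
Implicit Types f : T -> T -> T -> R.

Definition sum_distinct f : R :=
  \sum_x \sum_y \sum_(z | [&& x != y, x != z & y != z]) f x y z.

Lemma sum_distinctD f h : sum_distinct (fun x y z => f x y z + h x y z) =
  sum_distinct f + sum_distinct h.
Proof.
rewrite -big_split /=.
by do 2! (apply: eq_bigr => ? _; rewrite -big_split /=).
Qed.

Lemma sum_distinctZ c f :
  sum_distinct (fun x y z => c * f x y z) = c * sum_distinct f.
Proof.
by rewrite mulr_sumr; do 2! (apply: eq_bigr => ? _; rewrite mulr_sumr).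
Qed.

Lemma sum_distinct23 f : sum_distinct (fun x y z => f x z y) = sum_distinct f.
Proof.
rewrite /sum_distinct; apply: eq_bigr => x _.
under eq_bigr do rewrite big_mkcond.
under [RHS]eq_bigr do rewrite big_mkcond.
rewrite exchange_big; apply: eq_bigr => y _; apply: eq_bigr => z _.
by rewrite (eq_sym z y) andbCA.
Qed.

Lemma sum_distinct12 f : sum_distinct (fun x y z => f y x z) = sum_distinct f.
Proof.
rewrite /sum_distinct exchange_big; apply: eq_bigr => x _; apply: eq_bigr => y _.
by apply: eq_bigl => z; rewrite (eq_sym y x) (andbC (y != z)).
Qed.

Lemma sum_distinct_pair (h : T -> T -> R) :
  sum_distinct (fun x y _ => h x y) =
  (#|T|%:R - 2) * \sum_x \sum_(y | x != y) h x y.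
Proof.
rewrite mulr_sumr; apply: eq_bigr => x _; rewrite mulr_sumr [RHS]big_mkcond.
apply: eq_bigr => y _; case: eqVneq => [->|xy] /=; first by rewrite big_pred0_eq.
rewrite sumr_const -[LHS]mulr_natl; congr (_ * _).
have <- : #|[set x; y]| = 2%N by rewrite cards2 xy.
rewrite -(cardsC [set x; y]) natrD addrC addKr; congr _%:R.
by rewrite -cardsE; apply: eq_card => z; rewrite !inE negb_or !(eq_sym z).
Qed.

Lemma sum_distinct_sum (h : T -> T -> R) :
  sum_distinct (fun x y z => h x y + h x z + h y z) =
  3 * (#|T|%:R - 2) * \sum_x \sum_(y | x != y) h x y.
Proof.
rewrite !sum_distinctD (sum_distinct23 (fun x y _ => h x y)).
rewrite -(sum_distinct12 (fun x y z => h y z)).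
by rewrite (sum_distinct23 (fun x y _ => h x y)) sum_distinct_pair; ring.
Qed.

(** Triples are sorted by which of their points coincide. *)
Lemma sum_triples f : \sum_x \sum_y \sum_z f x y z = sum_distinct f +
  \sum_x \sum_(y | x != y) (f x x y + f x y x + f x y y) + \sum_x f x x x.
Proof.
rewrite -!big_split /=; apply: eq_bigr => x _.
rewrite (bigD1 x)//= (bigD1 x)//= [in RHS](bigD1 x)//= eqxx /= big_pred0_eq add0r.
have E y : y != x -> \sum_z f x y z = f x y x + (f x y y +
    \sum_(z | [&& x != y, x != z & y != z]) f x y z).
  move=> yx; rewrite (bigD1 x)//= (bigD1 y)//=; congr (_ + (_ + _)).
  by apply: eq_bigl => z; rewrite (eq_sym x y) yx !(eq_sym z).
have xE (h : T -> R) : \sum_(y | x != y) h y = \sum_(y | y != x) h y.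
  by apply: eq_bigl => y; rewrite eq_sym.
by rewrite (eq_bigr _ E) !big_split /= !xE; ring.
Qed.

End DistinctTriples.

Section SchoenbergKernel.
Variables (R : realType) (m : nat) (T : finType) (p : T -> 'rV[R]_m.+1).
Hypothesis m2 : (2 <= m)%N.
Hypothesis p_unit : forall i, dotv (p i) (p i) = 1.

Local Notation g := (fun i j => dotv (p i) (p j)).

(** The six orders of [u], [v], [t] come from the six orders of the points, and a sum over all
    triples does not see the order. *)
Lemma sum_symmetrize (q : R -> R -> R -> R) :
  \sum_x \sum_y \sum_z symmetrize q (g x y) (g x z) (g y z) =
  \sum_z \sum_x \sum_y q (g x z) (g y z) (g x y).
Proof.
pose G x y z := q (g x z) (g y z) (g x y).
have swap12 (f : T -> T -> T -> R) : \sum_x \sum_y \sum_z f x y z =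
  \sum_x \sum_y \sum_z f y x z by rewrite exchange_big.
have swap23 (f : T -> T -> T -> R) : \sum_x \sum_y \sum_z f x y z =
  \sum_x \sum_y \sum_z f x z y by apply: eq_bigr => x _; rewrite exchange_big.
transitivity (\sum_x \sum_y \sum_z G x y z); last first.
  by rewrite swap23 swap12.
transitivity (\sum_x \sum_y \sum_z 6^-1 *
  (G y z x + G x z y + G z y x + G x y z + G z x y + G y x z)).
  apply: eq_bigr => x _; apply: eq_bigr => y _; apply: eq_bigr => z _.
  by rewrite mulrC /symmetrize /G /= !(dotvC (p z)) (dotvC (p y) (p x)).
under eq_bigr do under eq_bigr do rewrite -mulr_sumr !big_split /=.
under eq_bigr do rewrite -mulr_sumr !big_split /=.
rewrite -mulr_sumr !big_split /=.
set S := \sum_x \sum_y \sum_z G x y z.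
have -> : \sum_x \sum_y \sum_z G y z x = S by rewrite swap12 swap23.
have -> : \sum_x \sum_y \sum_z G x z y = S by rewrite swap23.
have -> : \sum_x \sum_y \sum_z G z y x = S by rewrite swap12 swap23 swap12.
have -> : \sum_x \sum_y \sum_z G z x y = S by rewrite swap23 swap12.
have -> : \sum_x \sum_y \sum_z G y x z = S by rewrite swap12.
by field.
Qed.

Lemma sum_mxS_ge0 (A : infmx R) k : finsupp_mx A -> psd A ->
  0 <= \sum_x \sum_y \sum_z mxinner A (mxS m.+1 k (g x y) (g x z) (g y z)).
Proof.
move=> /mxinner_bounded[d dE] Apsd.
pose q i j (u v t : R) := u ^+ i * v ^+ j * zonal m k u v t.
have -> : \sum_x \sum_y \sum_z mxinner A (mxS m.+1 k (g x y) (g x z) (g y z)) =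
  \sum_z \sum_(i < d) \sum_(j < d) A i j *
    \sum_x \sum_y q i j (g x z) (g y z) (g x y).
  under eq_bigr do under eq_bigr do under eq_bigr do rewrite dE.
  under eq_bigr do under eq_bigr do rewrite exchange_big.
  under eq_bigr do rewrite exchange_big.
  rewrite exchange_big [RHS]exchange_big; apply: eq_bigr => i _ /=.
  under eq_bigr do under eq_bigr do rewrite exchange_big.
  under eq_bigr do rewrite exchange_big.
  rewrite exchange_big [RHS]exchange_big; apply: eq_bigr => j _ /=.
  under eq_bigr do under eq_bigr do rewrite -mulr_sumr.
  under eq_bigr do rewrite -mulr_sumr.
  by rewrite -!mulr_sumr -sum_symmetrize.
apply: sumr_ge0 => z _.
exact: (psd_gram_ge0 (fun x => dotv (p x) (p z)) _ Apsd
  (zonal_gram m2 k p_unit (p_unit z))).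
Qed.

End SchoenbergKernel.

Section ThreePointSums.
Variables (R : realType) (n N : nat).
Implicit Types (A : infmx R) (u v t : R).

Lemma mxinner_T A k u v t : finsupp_mx A ->
  mxinner A (mxT n N k u v t) = (N%:R - 2) * mxinner A (mxS n k u v t) +
    mxinner A (mxS n k u u 1) + mxinner A (mxS n k v v 1) +
    mxinner A (mxS n k t t 1).
Proof.
move=> /mxinner_bounded[d dE]; rewrite !dE mulr_sumr -!big_split /=.
apply: eq_bigr => i _; rewrite mulr_sumr -!big_split /=.
by apply: eq_bigr => j _; rewrite /mxT; ring.
Qed.

Lemma mxS_perm k u v t : [/\ mxS n k u v t = mxS n k v u t,
  mxS n k u v t = mxS n k u t v & mxS n k u v t = mxS n k t u v].
Proof.
by split; apply/funext => i; apply/funext => j; rewrite /mxS /symmetrize; ring.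
Qed.

(** At $(1,1,1)$ both $t-uv$ and the root are 0, so [zonal] survives only for [k = 0]. The
    inequality also covers the default value of [gegenbauer], through $\langle A, J\rangle \ge
    0$. *)
Lemma mxinner_S111_le A k : finsupp_mx A -> psd A ->
  mxinner A (mxS n k 1 1 1) <= if k == 0 then mxinner A mxJ else 0.
Proof.
move=> Afin Apsd; have J0 := mxinner_J_ge0 Afin Apsd.
move: Afin J0 => /mxinner_bounded[d dE]; rewrite !dE => J0.
have SE i j : mxS n k 1 1 1 i j = zonal n.-1 k 1 1 1 :> R.
  by rewrite /mxS /symmetrize !expr1n !mul1r; field.
have zE : zonal n.-1 k 1 1 1 = if k == 0 then (gegenbauer n.-1 0)`_0 else 0 :> R.
  rewrite /zonal !expr1n mulr1 subrr mul0r sqrtr0.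
  case: k {SE} => [|k]; first by rewrite big_ord1 !expr0 !mulr1.
  rewrite big1// => l _; have [l0|l0] := posnP l.
    by rewrite l0 subn0 (exprS 0) mul0r mulr0.
  by rewrite expr0n eqn0Ngt l0 mulr0 mul0r.
under eq_bigr do under eq_bigr do rewrite SE zE.
case: ifP => _; last first.
  by rewrite big1// => i _; rewrite big1// => j _; rewrite mulr0.
have g01 : (gegenbauer n.-1 0)`_0 = 1 :> R \/ (gegenbauer n.-1 0)`_0 = 0 :> R.
  rewrite /gegenbauer; case: xgetP => [P _ [sizeP P1 _]|_]; [left|right].
    by have := P1 0%N; rewrite (@size1_polyC _ (P 0%N)) ?sizeP// hornerC coefC.
  by rewrite coef0.
case: g01 => ->; first exact: lexx.
by rewrite big1// => i _; rewrite big1// => j _; rewrite mulr0.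
Qed.

End ThreePointSums.

Section TripleSumBound.
Variables (R : realType) (m N : nat) (T : finType) (p : T -> 'rV[R]_m.+1).
Hypothesis m2 : (2 <= m)%N.
Hypothesis N2 : (2 < N)%N.
Hypothesis p_unit : forall i, dotv (p i) (p i) = 1.
Hypothesis cardT : #|T| = N.

Local Notation g := (fun i j => dotv (p i) (p j)).

(** A triple with exactly two equal points has inner products [a], [a], [1] in some order. The terms
    $S_k(u,u,1)$ of $T_k$ thus supply these degenerate triples, and only the diagonal is missing
    from the full sum. *)
Lemma sum_mxT_ge (A : infmx R) k : finsupp_mx A -> psd A ->
  - ((N%:R - 2) * N%:R * if k == 0 then mxinner A mxJ else 0) <=
  sum_distinct (fun x y z => mxinner A (mxT m.+1 N k (g x y) (g x z) (g y z))).
Proof.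
move=> Afin Apsd.
pose Q u v t := mxinner A (mxS m.+1 k u v t).
pose q (a : R) := Q a a 1.
pose E2 := \sum_x \sum_(y | x != y) q (g x y).
have N2R : 0 < N%:R - 2 :> R by rewrite subr_gt0 ltr_nat.
have -> : sum_distinct (fun x y z =>
    mxinner A (mxT m.+1 N k (g x y) (g x z) (g y z))) =
    (N%:R - 2) * (sum_distinct (fun x y z => Q (g x y) (g x z) (g y z)) + 3 * E2).
  transitivity (sum_distinct (fun x y z =>
    (N%:R - 2) * Q (g x y) (g x z) (g y z) +
    (q (g x y) + q (g x z) + q (g y z)))).
    do 2! (apply: eq_bigr => ? _); apply: eq_bigr => ? _.
    by rewrite mxinner_T// -!addrA.
  rewrite sum_distinctD sum_distinctZ (sum_distinct_sum (fun x y => q (g x y))).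
  by rewrite cardT -/E2; ring.
have := sum_triples (fun x y z => Q (g x y) (g x z) (g y z)).
have -> : \sum_x \sum_(y | x != y) (Q (g x x) (g x y) (g x y) +
    Q (g x y) (g x x) (g y x) + Q (g x y) (g x y) (g y y)) = 3 * E2.
  rewrite mulr_sumr; apply: eq_bigr => x _; rewrite mulr_sumr.
  apply: eq_bigr => y _; rewrite !p_unit (dotvC (p y)) /q /Q.
  set a := dotv _ _.
  have [_ -> _] := mxS_perm m.+1 k a 1 a.
  have [_ _ ->] := mxS_perm m.+1 k 1 a a.
  by have [_ _ ->] := mxS_perm m.+1 k a 1 a; ring.
have -> : \sum_x Q (g x x) (g x x) (g x x) = N%:R * Q 1 1 1.
  under eq_bigr do rewrite p_unit.
  by rewrite sumr_const cardT -[LHS]mulr_natl.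
have := sum_mxS_ge0 m2 p_unit k Afin Apsd; rewrite -/Q => ge0 sumE.
rewrite -mulrA -mulrN ler_pM2l//.
have := mxinner_S111_le m.+1 k Afin Apsd; rewrite -/(Q 1 1 1) => Q1.
have : N%:R * Q 1 1 1 <= N%:R * (if k == 0 then mxinner A mxJ else 0).
  by rewrite ler_wpM2l ?ler0n.
by move: ge0; rewrite sumE; lra.
Qed.

End TripleSumBound.

Theorem theorem7 (R : realType) (n N : nat) (f : R -> R) (c : R)
    (F : nat -> infmx R) :
  (3 <= n)%N -> (2 < N)%N ->
  (forall k, symmetric_mx (F k)) ->
  (forall k, finsupp_mx (F k)) ->
  (forall u v t : R, inD u v t -> cvgn (series (Hterm n N F u v t))) ->
  (forall k, psd (F k)) ->
  (forall u v t : R, inD u v t ->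
    Hfun n N c F u v t <= (f u + f v + f t) / 3) ->
  forall C : {fset 'rV[R]_n}, on_sphere C -> #|` C| = N ->
    N%:R / 2 * ((N%:R - 1) * c - mxinner (F 0%N) mxJ) <= energy f C.
Proof.
case: n => // m m2 N2 _ Ffin Fcvg Fpsd Hle C Csph CN.
pose T : finType := C; pose p (x : T) : 'rV[R]_m.+1 := val x.
have p_unit x : dotv (p x) (p x) = 1 by apply: Csph; exact: valP.
have p_neq x y : x != y -> p x != p y by rewrite /p (inj_eq val_inj).
have cardT : #|T| = N by rewrite -CN cardfE.
pose g x y := dotv (p x) (p y).
have gD x y z : [&& x != y, x != z & y != z] -> inD (g x y) (g x z) (g y z).
  move=> /and3P[xy xz yz].
  by apply: (inD_unit (p_unit x) (p_unit y) (p_unit z)); apply: p_neq.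
have N2R : 0 < N%:R - 2 :> R by rewrite subr_gt0 ltr_nat.
(* Each ordered pair is counted $3(N-2)$ times, and the bound on $H$ divides by 3. *)
have upper : sum_distinct (fun x y z => Hfun m.+1 N c F (g x y) (g x z) (g y z))
    <= (N%:R - 2) * (2 * energy f C).
  have -> : 2 * energy f C = \sum_(x : T) \sum_(y | x != y) f (g x y).
    rewrite /energy mulrA divff ?mul1r ?pnatr_eq0//.
    rewrite big_seq_fsetE /=; apply: eq_bigr => x _.
    by rewrite big_seq_fsetE /=; apply: eq_bigl => y; rewrite (inj_eq val_inj).
  have := sum_distinct_sum (fun x y => f (g x y)); rewrite cardT => E.
  have -> : (N%:R - 2) * (\sum_(x : T) \sum_(y | x != y) f (g x y)) =
      3^-1 * sum_distinct (fun x y z => f (g x y) + f (g x z) + f (g y z)).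
    by rewrite E; field.
  rewrite -sum_distinctZ; do 2! (apply: ler_sum => ? _); apply: ler_sum => ? xyz.
  by rewrite mulrC; apply: Hle; exact: gD.
pose B := (N%:R - 2) * N%:R * mxinner (F 0%N) mxJ.
have B0 : 0 <= B by rewrite !mulr_ge0 ?ler0n ?(ltW N2R)// mxinner_J_ge0.
have lower : N%:R * (N%:R - 1) * (N%:R - 2) * c - B <=
    sum_distinct (fun x y z => Hfun m.+1 N c F (g x y) (g x z) (g y z)).
  rewrite /Hfun sum_distinctD; apply: lerD.
    rewrite (sum_distinct_pair (fun _ _ : T => c)) cardT.
    have xc (x : T) : \sum_(y | x != y) c = (N%:R - 1) * c.
      rewrite sumr_const -[LHS]mulr_natl; congr (_ * _).
      rewrite -(natrB _ (ltnW (ltnW N2))) subn1 -cardT -(cardC1 x).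
      by congr _%:R; apply: eq_card => y; rewrite !inE eq_sym.
    under eq_bigr do rewrite xc.
    have -> : \sum_(x : T) (N%:R - 1) * c = N%:R * ((N%:R - 1) * c).
      by rewrite sumr_const cardT -[LHS]mulr_natl.
    by lra.
  (* A finite sum of convergent series: a lower bound on every partial sum passes to the limit. *)
  pose u K := sum_distinct (fun x y z =>
    series (Hterm m.+1 N F (g x y) (g x z) (g y z)) K).
  have ucvg : (u K @[K --> \oo] --> sum_distinct (fun x y z =>
      limn (series (Hterm m.+1 N F (g x y) (g x z) (g y z)))))%classic.
    apply: cvg_big => [|x _]; first exact: add_continuous.
    apply: cvg_big => [|y _]; first exact: add_continuous.
    apply: cvg_big => [|z xyz]; first exact: add_continuous.
    exact: Fcvg (gD _ _ _ xyz).
  apply: (cvgr_to_ge ucvg); apply: nearW => K.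
  have -> : u K = \sum_(0 <= k < K) sum_distinct (fun x y z =>
      Hterm m.+1 N F (g x y) (g x z) (g y z) k).
    rewrite /u /sum_distinct /series /= [RHS]exchange_big /=; apply: eq_bigr => x _.
    rewrite [RHS]exchange_big /=; apply: eq_bigr => y _.
    by rewrite [RHS]exchange_big.
  apply: (@le_trans _ _ (\sum_(0 <= k < K) - (if k == 0 then B else 0))).
    (* The empty partial sum is 0, so [B0] enters here. *)
    case: K => [|K]; first by rewrite !big_geq// oppr_le0.
    rewrite big_nat_recl// big1 ?addr0// => k _.
    by rewrite oppr0.
  apply: ler_sum => k _.
  apply: le_trans (sum_mxT_ge m2 N2 p_unit cardT k (Ffin k) (Fpsd k)).
  by case: k => [|k]//=; rewrite mulr0 oppr0.
have := le_trans lower upper; rewrite -subr_ge0.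
have -> : (N%:R - 2) * (2 * energy f C) -
    (N%:R * (N%:R - 1) * (N%:R - 2) * c - B) =
  (N%:R - 2) * 2 *
    (energy f C - N%:R / 2 * ((N%:R - 1) * c - mxinner (F 0%N) mxJ)).
  by rewrite /B; field.
by rewrite pmulr_rge0 ?mulr_gt0// subr_ge0.
Qed.
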